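(* There is a deterministic algorithm and an absolute constant $C$ such that the following holds. Let $R$ be any finite commutative ring with $1$, with $|R|=q>1$, let $n$ be a positive integer with $(n,q)\neq(1,2)$, and let $A$ be an $n\times n$ matrix over $R$. Given $n$, $q$, the matrix $A$, and the binary representation of $\lceil n\log_2 q\rceil$, the algorithm correctly decides whether the linear system $R^n\to R^n$, $x\mapsto Ax$, is a fixed point system, using at most $C\,n^3\log_2(n\log_2 q)$ operations in $R$.
   Context: An operation in $R$ is an addition, a multiplication, or an equality test of two elements of $R$; these operations, and the elements $0,1\in R$, are assumed to be available to the algorithm (the ring operations are implemented), and the running time is measured by the number of such operations. Elements of $R^n$ are viewed as column vectors. A finite dynamical system is a function $f:X\to X$ on a finite set $X$. It is called a fixed point system if every cycle (periodic orbit) of $f$ has length one; that is, whenever $x\in X$ and $f^m(x)=x$ for some positive integer $m$, one has $f(x)=x$. *)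

(* Defs.v *)
From mathcomp Require Import all_boot all_order all_algebra.
From mathcomp Require Import reals exp Rstruct.

Set Implicit Arguments.
Unset Strict Implicit.
Unset Printing Implicit Defensive.

Import Order.TTheory GRing.Theory Num.Theory.

Local Open Scope ring_scope.

Definition fixed_point_system (X : finType) (f : X -> X) : Prop :=
  forall (x : X) (m : nat), (0 < m)%N -> iter m f x = x -> f x = x.

Definition log2 (K : realType) (x : K) : K := ln x / ln 2.

Definition ceil_nlog2q (n q : nat) : nat :=
  `|Num.ceil (n%:R * log2 (q%:R : Rdefinitions.R))|%N.

(* Least significant bit first and, for m > 0, no leading zero. *)
Definition binary (m : nat) : seq bool :=
  mkseq (fun i => odd (m %/ 2 ^ i)) (trunc_log 2 m).+1.

(* Algorithms over a black-box ring are programs for a random access machine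
   with two memories indexed by natural numbers: one holds natural numbers,
   the other holds ring elements.  The program text does not mention the ring.
   Ring elements are only accessible through the instructions below, and the
   only information that flows from ring elements to natural numbers is the
   outcome of equality tests. *)
Inductive nexpr :=
  | Cst (k : nat)
  | Fetch (a : nexpr)
  | Plus (e1 e2 : nexpr)
  | Minus (e1 e2 : nexpr)
  | Times (e1 e2 : nexpr).

Inductive prog :=
  | Skip
  | Seq (p1 p2 : prog)
  | NatSet (a e : nexpr)
  | RingZero (a : nexpr)
  | RingOne (a : nexpr)
  | RingCopy (a b : nexpr)
  | RingAdd (a b c : nexpr)
  | RingMul (a b c : nexpr)
  | RingEq (a b c : nexpr)
  | If (e : nexpr) (p1 p2 : prog)
  | While (e : nexpr) (p : prog).

Record state (R : Type) := State { nmem : nat -> nat; rmem : nat -> R }.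

Fixpoint neval (mem : nat -> nat) (e : nexpr) : nat :=
  match e with
  | Cst k => k
  | Fetch a => mem (neval mem a)
  | Plus e1 e2 => neval mem e1 + neval mem e2
  | Minus e1 e2 => neval mem e1 - neval mem e2
  | Times e1 e2 => neval mem e1 * neval mem e2
  end%N.

Definition upd (T : Type) (mem : nat -> T) (a : nat) (v : T) : nat -> T :=
  fun b => if b == a then v else mem b.

Definition nset (R : Type) (s : state R) (a v : nat) : state R :=
  State (upd (nmem s) a v) (rmem s).

Definition rset (R : Type) (s : state R) (a : nat) (v : R) : state R :=
  State (nmem s) (upd (rmem s) a v).

(* exec p s t s' : started in state s, the program p halts in state s' after
   exactly t operations in the ring.  Only additions, multiplications and
   equality tests of ring elements are counted. *)
Inductive exec (R : comNzRingType) :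
    prog -> state R -> nat -> state R -> Prop :=
  | ExecSkip s : exec Skip s 0 s
  | ExecSeq p1 p2 s s1 s2 t1 t2 :
      exec p1 s t1 s1 -> exec p2 s1 t2 s2 -> exec (Seq p1 p2) s (t1 + t2) s2
  | ExecNatSet a e s :
      exec (NatSet a e) s 0 (nset s (neval (nmem s) a) (neval (nmem s) e))
  | ExecRingZero a s :
      exec (RingZero a) s 0 (rset s (neval (nmem s) a) 0)
  | ExecRingOne a s :
      exec (RingOne a) s 0 (rset s (neval (nmem s) a) 1)
  | ExecRingCopy a b s :
      exec (RingCopy a b) s 0
           (rset s (neval (nmem s) a) (rmem s (neval (nmem s) b)))
  | ExecRingAdd a b c s :
      exec (RingAdd a b c) s 1
           (rset s (neval (nmem s) a)
                 (rmem s (neval (nmem s) b) + rmem s (neval (nmem s) c)))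
  | ExecRingMul a b c s :
      exec (RingMul a b c) s 1
           (rset s (neval (nmem s) a)
                 (rmem s (neval (nmem s) b) * rmem s (neval (nmem s) c)))
  | ExecRingEq a b c s :
      exec (RingEq a b c) s 1
           (nset s (neval (nmem s) a)
                 (rmem s (neval (nmem s) b) == rmem s (neval (nmem s) c)))
  | ExecIfTrue e p1 p2 s s' t :
      neval (nmem s) e <> 0%N -> exec p1 s t s' -> exec (If e p1 p2) s t s'
  | ExecIfFalse e p1 p2 s s' t :
      neval (nmem s) e = 0%N -> exec p2 s t s' -> exec (If e p1 p2) s t s'
  | ExecWhileStop e p s :
      neval (nmem s) e = 0%N -> exec (While e p) s 0 s
  | ExecWhileLoop e p s s1 s2 t1 t2 :
      neval (nmem s) e <> 0%N -> exec p s t1 s1 -> exec (While e p) s1 t2 s2 ->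
      exec (While e p) s (t1 + t2) s2.

Lemma exec_deterministic (R : comNzRingType) p (s s1 s2 : state R) t1 t2 :
  exec p s t1 s1 -> exec p s t2 s2 -> t1 = t2 /\ s1 = s2.
Proof.
move=> h1; elim: h1 t2 s2 => {p s t1 s1}.
all: intros; match goal with h : exec _ _ _ ?s |- _ /\ _ = ?s =>
  inversion h; subst end; try by [].
all: repeat match goal with
  | IH : (forall t s, exec ?p ?u t s -> _), h : exec ?p ?u _ _ |- _ =>
      case: (IH _ _ h) => ? ?; clear IH; subst
  end; by [].
Qed.

(* Nat cells 0, 1, 2 hold n, q and the number of bits in b, which follow from
   cell 3 on; ring cell i * n + j holds A i j.  All other cells hold 0. *)
Definition input (R : comNzRingType) (n q : nat) (A : 'M[R]_n) (b : seq bool) :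
    state R :=
  State (nth 0%N [:: n, q, size b & map nat_of_bool b])
        (nth 0 [seq A i j | i <- enum 'I_n, j <- enum 'I_n]).

(* The answer is read in nat cell 0. *)
Definition accepts (R : Type) (s : state R) : Prop := nmem s 0%N = 1%N.
Definition rejects (R : Type) (s : state R) : Prop := nmem s 0%N = 0%N.

(* Main.v *)
Require Import Defs.
From mathcomp Require Import all_boot all_order all_algebra.
From mathcomp Require Import reals exp Rstruct.
From mathcomp Require Import zify lra.

Import Order.TTheory GRing.Theory Num.Theory.

Local Open Scope ring_scope.

(** The images of the powers [A ^+ k] form a decreasing chain of submodules of
    [R ^ n]; each proper inclusion at least halves the cardinality, and once two
    consecutive images agree the chain is constant.  So the chain is stationary
    from [m] on as soon as [q ^ n <= 2 ^ m].  The periodic points are the points of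
    the stationary image, hence the system is a fixed point system iff
    [A *m A ^+ m = A ^+ m].  For [m] one can take the power of two [2 ^ K], with
    [K] the number of bits of the ceiling of [n log2 q]; then [K] squarings and
    one more product, of [2 n ^ 3] operations each, followed by [n ^ 2] equality
    tests suffice.  The digits themselves are not read. *)

(** * Fixed point systems and stationary powers *)

Section FixedPointCriterion.
Variables (R : finComNzRingType) (n : nat) (A : 'M[R]_n).
Implicit Types (x y : 'cV[R]_n) (k m : nat).

Let image k : {set 'cV[R]_n} := [set A ^+ k *m x | x in setT].

Lemma iter_mulmx m x : iter m (fun y => A *m y) x = A ^+ m *m x.
Proof.
elim: m => [|m IH]; first by rewrite expr0 mul1mx.
by rewrite iterS IH exprS mulmxA.
Qed.

Lemma image_power_subset k : image k.+1 \subset image k.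
Proof.
apply/subsetP=> _ /imsetP[x _ ->].
by rewrite exprSr -mulmxE -mulmxA imset_f ?inE.
Qed.

(** Applying [A ^+ j] to [A ^+ k *m x = A ^+ k.+1 *m y] shifts both exponents by [j], so an equality
    of consecutive images persists. *)
Lemma image_power_stable k j :
  image k.+1 = image k -> image (k + j).+1 = image (k + j).
Proof.
move=> eq_k; apply/eqP; rewrite eqEsubset image_power_subset /=.
apply/subsetP=> _ /imsetP[x _ ->].
have: A ^+ k *m x \in image k by rewrite imset_f ?inE.
rewrite -eq_k => /imsetP[y _ eq_xy].
rewrite addnC exprD -mulmxA eq_xy mulmxA mulmxE -exprD addnS.
by rewrite imset_f ?inE.
Qed.

(* A translate of the smaller image by an element it misses is disjoint from it,
   and both fit into the larger image. *)
Lemma card_image_power_drop k :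
  image k.+1 != image k -> (2 * #|image k.+1| <= #|image k|)%N.
Proof.
move=> neq_k.
have /subsetPn[_ /imsetP[u _ ->]] : ~~ (image k \subset image k.+1).
  by apply: contra neq_k; rewrite eqEsubset image_power_subset.
set y := A ^+ k *m u => y_notin.
have transl : #|[set y + z | z in image k.+1]| = #|image k.+1|.
  by apply: card_imset; apply: addrI.
have disj : [disjoint image k.+1 & [set y + z | z in image k.+1]].
  apply/pred0P=> v /=; apply/andP=> -[/imsetP[a _ ->] /imsetP[_ /imsetP[b _ ->]]].
  move=> eq_ab; case/negP: y_notin.
  have -> : y = A ^+ k.+1 *m (a - b) by rewrite mulmxBr eq_ab addrK.
  by rewrite imset_f ?inE.
have [_ /esym] := leq_card_setU (image k.+1) [set y + z | z in image k.+1].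
rewrite disj transl addnn -mul2n => /esym/eqP <-; apply: subset_leq_card.
rewrite subUset image_power_subset /=; apply/subsetP=> _ /imsetP[z z_in ->].
have /imsetP[w _ ->] := subsetP (image_power_subset k) _ z_in.
by rewrite /y -mulmxDr imset_f ?inE.
Qed.

(** If the chain still drops at step [m], it drops at every earlier step as well. These [m.+1]
    halvings leave at most half a point, yet the image contains 0. *)
Lemma image_power_stabilizes m :
  (#|R| ^ n <= 2 ^ m)%N -> image m.+1 = image m.
Proof.
move=> le_m; apply/eqP/negPn/negP => neq_m.
have bound k : (k <= m.+1)%N -> (2 ^ k * #|image k| <= #|R| ^ n)%N.
  elim: k => [|k IH] lt_km.
    by rewrite mul1n (leq_trans (max_card _)) // card_mx muln1.
  apply: leq_trans (IH (ltnW lt_km)); rewrite expnSr -mulnA leq_pmul2l ?expn_gt0 //.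
  apply: card_image_power_drop; apply: contraNneq neq_m => eq_k.
  by rewrite -(subnKC (lt_km : k <= m)%N) image_power_stable.
have := leq_trans (bound _ (leqnn _)) le_m.
rewrite leqNgt expnS mulnAC -[X in (X < _)%N]mul1n ltn_pmul2r ?expn_gt0 //.
have : (0 < #|image m.+1|)%N.
  by rewrite card_gt0; apply/set0Pn; exists (A ^+ m.+1 *m 0); rewrite imset_f ?inE.
by case: #|_| => // c _; rewrite mulnS.
Qed.

(** Pigeonhole: the matrix ring is finite, so two powers of [A] coincide. *)
Lemma powers_eventually_periodic :
  exists a p, (0 < p)%N /\ A ^+ (a + p) = A ^+ a.
Proof.
have /injectivePn[i [j neq_ij eq_ij]] :
    ~~ injectiveb (fun i : 'I_#|{: 'M[R]_n}|.+1 => A ^+ i).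
  by apply/negP => /injectiveP /leq_card; rewrite card_ord ltnn.
wlog lt_ij : i j neq_ij eq_ij / (i < j)%N.
  move=> H; have [lt_ij|lt_ji|eq_v] := ltngtP i j; first exact: (H i j).
    by apply: (H j i); rewrite // eq_sym.
  by case/eqP: neq_ij; apply: val_inj.
by exists i, (j - i)%N; rewrite subn_gt0 subnKC // ltnW.
Qed.

Lemma fixed_point_system_mulmxP m : (#|R| ^ n <= 2 ^ m)%N ->
  fixed_point_system (fun x : 'cV[R]_n => A *m x) <-> A *m A ^+ m = A ^+ m.
Proof.
move=> le_m; split=> [fps|fix_m x p p_gt0].
  have [a [p [p_gt0 per]]] := powers_eventually_periodic.
  (* [A ^+ a *m x] returns to itself after [p] steps, hence is fixed. *)
  have fix_a x : A *m (A ^+ a *m x) = A ^+ a *m x.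
    by apply: (fps _ p p_gt0); rewrite iter_mulmx mulmxA mulmxE -exprD addnC per.
  (* Each column of [A ^+ m] thus has the form [A ^+ (a + m) *m x], which is a fixed point. *)
  have im_eq : image m = image (a + m).
    rewrite addnC; elim: a {per fix_a} => [|a IH]; first by rewrite addn0.
    by rewrite addnS image_power_stable // image_power_stabilizes.
  apply/matrixP=> i j.
  have col_fix : A *m (A ^+ m *m (delta_mx j 0 : 'cV_n)) = A ^+ m *m delta_mx j 0.
    have : A ^+ m *m (delta_mx j 0 : 'cV_n) \in image (a + m).
      by rewrite -im_eq imset_f ?inE.
    by case/imsetP=> x _ ->; rewrite exprD -mulmxE -mulmxA fix_a.
  move: col_fix; rewrite mulmxA -!colE => /(congr1 (fun u : 'cV_n => u i 0)).
  by rewrite !mxE.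
rewrite iter_mulmx => per.
(* Going [m] times through [p] steps gives [x = A ^+ (p * m) *m x]; since [m <= p * m], this power
   equals [A ^+ m]. *)
have iter_per k : A ^+ (p * k) *m x = x.
  elim: k => [|k IH]; first by rewrite muln0 mul1mx.
  by rewrite mulnS exprD -mulmxE -mulmxA IH per.
have stable j : A ^+ (m + j) = A ^+ m.
  elim: j => [|j IH]; first by rewrite addn0.
  by rewrite addnS exprS IH -mulmxE fix_m.
have -> : x = A ^+ m *m x.
  rewrite -{1}(iter_per m) -(@subnKC m (p * m)) ?leq_pmull //.
  by rewrite stable.
by rewrite mulmxA fix_m.
Qed.

End FixedPointCriterion.

(** * Logarithms and the operation count *)

Section Log2.
Variable K : realType.
Implicit Types (x y : K) (k : nat).

Lemma ln2_gt0 : 0 < ln (2 : K).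
Proof. by rewrite ln_gt0 // ltr1n. Qed.

Lemma log2_exp k : log2 (2 ^+ k : K) = k%:R.
Proof. by rewrite /log2 lnXn // -[X in X / _]mulr_natl mulfK // gt_eqF //; exact: ln2_gt0. Qed.

Lemma log2_2 : log2 (2 : K) = 1.
Proof. exact: (log2_exp 1). Qed.

Lemma log2X x k : 0 < x -> log2 (x ^+ k) = k%:R * log2 x.
Proof. by move=> x_gt0; rewrite /log2 lnXn // -[X in X / _]mulr_natl mulrA. Qed.

Lemma ler_log2 x y : 0 < x -> 0 < y -> (log2 x <= log2 y) = (x <= y).
Proof.
by move=> x_gt0 y_gt0; rewrite /log2 ler_pM2r ?invr_gt0 ?ln2_gt0 // ler_ln.
Qed.

Lemma log2M2 x : 0 < x -> log2 (2 * x) = 1 + log2 x.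
Proof.
move=> x_gt0; rewrite /log2 lnM ?posrE // mulrDl divff // gt_eqF //.
exact: ln2_gt0.
Qed.

(** This keeps [n log2 q] away from 1, where the logarithm in the cost bound vanishes. For [q >= 3]
    it follows from [2 ^ 3 <= 3 ^ 2]; for [q = 2] from [n >= 2]. *)
Lemma three_halves_le_nlog2q n q : (1 < q)%N -> (0 < n)%N ->
  (n, q) <> (1%N, 2%N) -> 3 / 2 <= n%:R * log2 (q%:R : K).
Proof.
move=> q_gt1 n_gt0 nq_neq.
have q_gt0 : 0 < (q%:R : K) by rewrite ltr0n ltnW.
have ge1 : 1 <= log2 (q%:R : K).
  by rewrite -[X in X <= _]log2_2 ler_log2 // ler_nat.
have [lt_2q|le_q2] := ltnP 2 q.
  have : 3 / 2 <= log2 (q%:R : K).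
    have : 3 <= 2 * log2 (q%:R : K).
      rewrite -(log2_exp 3) -log2X // ler_log2 ?exprn_gt0 // -!natrX ler_nat.
      by apply: (@leq_trans (3 ^ 2)); rewrite // leq_sqr.
    by lra.
  have : 1 <= (n%:R : K) by rewrite ler1n.
  by nra.
have n_ge2 : 2 <= (n%:R : K).
  by rewrite ler_nat; case: n n_gt0 nq_neq => [//|[|//]] _; case; congr pair; lia.
by nra.
Qed.

End Log2.

Lemma size_binary m : size (binary m) = (trunc_log 2 m).+1.
Proof. exact: size_mkseq. Qed.

(** * Bit length of the ceiling of [n log2 q] *)

Section InputLength.
Variables n q : nat.
Hypotheses (q_gt1 : (1 < q)%N) (n_gt0 : (0 < n)%N).

Let N := ceil_nlog2q n q.
Let r : Rdefinitions.R := n%:R * log2 q%:R.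

Lemma nlog2q_ge0 : 0 <= r.
Proof.
by rewrite mulr_ge0 // divr_ge0 ?(ltW (ln2_gt0 _)) // ln_ge0 // ler1n ltnW.
Qed.

Lemma ceil_nlog2qE : N%:R = (Num.ceil r)%:~R :> Rdefinitions.R.
Proof.
have : 0 <= Num.ceil r by rewrite ceil_ge0 (lt_le_trans _ nlog2q_ge0) // ltrN10.
by rewrite /N /ceil_nlog2q -/r; case: (Num.ceil r).
Qed.

(** [N] is at least [n log2 q], so [q ^ n <= 2 ^ N], and [N] is less than 2 to the power of its bit
    length. *)
Lemma expn_le_pow2_binary : (q ^ n <= 2 ^ 2 ^ size (binary N))%N.
Proof.
have q_gt0 : 0 < (q%:R : Rdefinitions.R) by rewrite ltr0n ltnW.
apply: (@leq_trans (2 ^ N)).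
  rewrite -(ler_nat Rdefinitions.R) !natrX -ler_log2 ?exprn_gt0 //.
  by rewrite log2_exp log2X // ceil_nlog2qE ceil_ge.
by rewrite leq_exp2l // ltnW // size_binary trunc_log_ltn.
Qed.

(** Rounding up gives [N < r + 1 <= 2 * r], so [trunc_log 2 N <= 1 + log2 r]. *)
Lemma size_binary_le : 3 / 2 <= r ->
  (size (binary N))%:R <= log2 r + 2.
Proof.
move=> r_ge; rewrite size_binary -addn1 natrD.
suff : (trunc_log 2 N)%:R <= 1 + log2 r by lra.
have N_lt : N%:R < r + 1.
  by have := ceilB1_lt r; rewrite ceil_nlog2qE intrB ltrBlDr.
have N_ge : r <= N%:R by rewrite ceil_nlog2qE ceil_ge.
have N_gt0 : (0 < N)%N by rewrite -(ltr_nat Rdefinitions.R); lra.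
rewrite -log2M2; last by lra.
rewrite -(log2_exp _ (trunc_log 2 N)) ler_log2 ?exprn_gt0 //; last by lra.
have [] := andP (trunc_log_bounds (isT : 1 < 2)%N N_gt0).
rewrite -(ler_nat Rdefinitions.R) natrX => le_N _.
by apply: le_trans le_N _; lra.
Qed.

End InputLength.

(** With [K <= L + 2] the count is at most [(2 K + 3) n ^ 3 <= (2 L + 7) n ^ 3]; since [L >= 1 / 2],
    the 7 is at most [14 L], whence the constant 16. *)
Lemma cost_bound (n q : nat) : (1 < q)%N -> (0 < n)%N ->
  (n, q) <> (1%N, 2%N) ->
  (size (binary (ceil_nlog2q n q)) * (n * (n * (n * 2)))
     + (n * (n * (n * 2)) + n * n))%:R
    <= 16 * n%:R ^+ 3 * log2 (n%:R * log2 q%:R) :> Rdefinitions.R.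
Proof.
move=> q_gt1 n_gt0 nq_neq; set K := size _.
have r_ge := three_halves_le_nlog2q Rdefinitions.R n q q_gt1 n_gt0 nq_neq.
have := @size_binary_le n q q_gt1 r_ge.
rewrite -/K; move: K => K; set r := n%:R * log2 _ in r_ge *; set L := log2 r => le_K.
have L_ge : 1 / 2 <= L.
  have r_gt0 : 0 < r by lra.
  (* From [r >= 3 / 2] one gets [r ^ 2 >= 9 / 4 >= 2]. *)
  have : 1 <= 2 * L.
    rewrite -[X in X <= _](log2_2 Rdefinitions.R) -log2X // ler_log2 ?exprn_gt0 //.
    by rewrite expr2; nra.
  by lra.
have n_ge1 : 1 <= (n%:R : Rdefinitions.R) by rewrite ler1n.
have n3_ge : n%:R ^+ 2 <= (n%:R : Rdefinitions.R) ^+ 3.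
  by rewrite ler_weXn2l.
have n3_ge0 : 0 <= (n%:R : Rdefinitions.R) ^+ 3 by rewrite exprn_ge0 // ler0n.
apply: (@le_trans _ _ ((2 * K%:R + 3) * n%:R ^+ 3)).
  by rewrite !natrD !natrM; move: n3_ge; rewrite !exprS !expr0; lra.
by rewrite [leRHS]mulrAC ler_wpM2r //; lra.
Qed.

(** * Total correctness of programs *)

(** Total correctness with an exact count [t], so that counts add along [Seq] and multiply in
    loops. *)
Definition runs {R : comNzRingType} (p : prog) (s : state R) (t : nat)
    (Q : state R -> Prop) : Prop :=
  exists2 s', exec p s t s' & Q s'.

Section Runs.
Variable R : comNzRingType.
Implicit Types (s : state R) (Q : state R -> Prop).

Lemma runs_weaken Q1 Q2 p s t :
  (forall s', Q1 s' -> Q2 s') -> runs p s t Q1 -> runs p s t Q2.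
Proof. by move=> Q12 [s' ex /Q12]; exists s'. Qed.

Lemma runs_seq t1 t2 p1 p2 s Q :
  runs p1 s t1 (fun s1 => runs p2 s1 t2 Q) -> runs (Seq p1 p2) s (t1 + t2) Q.
Proof. by move=> [s1 ex1 [s2 ex2 Qs2]]; exists s2 => //; apply: ExecSeq ex1 ex2. Qed.

Lemma runs_nat_set a e s Q :
  Q (nset s (neval (nmem s) a) (neval (nmem s) e)) -> runs (NatSet a e) s 0 Q.
Proof. by eexists; [apply: ExecNatSet|]. Qed.

Lemma runs_ring_zero a s Q :
  Q (rset s (neval (nmem s) a) 0) -> runs (RingZero a) s 0 Q.
Proof. by eexists; [apply: ExecRingZero|]. Qed.

Lemma runs_ring_add a b c s Q :
  Q (rset s (neval (nmem s) a)
       (rmem s (neval (nmem s) b) + rmem s (neval (nmem s) c))) ->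
  runs (RingAdd a b c) s 1 Q.
Proof. by eexists; [apply: ExecRingAdd|]. Qed.

Lemma runs_ring_mul a b c s Q :
  Q (rset s (neval (nmem s) a)
       (rmem s (neval (nmem s) b) * rmem s (neval (nmem s) c))) ->
  runs (RingMul a b c) s 1 Q.
Proof. by eexists; [apply: ExecRingMul|]. Qed.

Lemma runs_ring_eq a b c s Q :
  Q (nset s (neval (nmem s) a)
       (rmem s (neval (nmem s) b) == rmem s (neval (nmem s) c))) ->
  runs (RingEq a b c) s 1 Q.
Proof. by eexists; [apply: ExecRingEq|]. Qed.

End Runs.

Local Notation cell a := (Fetch (Cst a)).

Definition For (c : nat) (e : nexpr) (p : prog) : prog :=
  Seq (NatSet (Cst c) (Cst 0))
      (While (Minus e (cell c)) (Seq p (NatSet (Cst c) (Plus (cell c) (Cst 1))))).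

(** [I k] describes the state before round [k] and must determine the counter and the bound. The
    body has to give the counter back unchanged; the loop increments it at no cost in ring
    operations. *)
Lemma runs_for (R : comNzRingType) (I : nat -> state R -> Prop) c e p N T s :
  (forall k s, (k <= N)%N -> I k s -> nmem s c = k /\ neval (nmem s) e = N) ->
  I 0 (nset s c 0) ->
  (forall k s, (k < N)%N -> I k s ->
     runs p s T (fun s' => nmem s' c = k /\ I k.+1 (nset s' c k.+1))) ->
  runs (For c e p) s (N * T) (I N).
Proof.
move=> I_ctr I0 I_body.
(* Induction on the number [d] of rounds left. *)
suff loop d k s1 : (k + d = N)%N -> I k s1 ->
    runs (While (Minus e (cell c))
            (Seq p (NatSet (Cst c) (Plus (cell c) (Cst 1))))) s1 (d * T) (I N).
  by apply: (@runs_seq _ 0); apply: runs_nat_set; apply: loop I0.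
elim: d k s1 => [|d IH] k s1 eq_N Ik; have le_kN : (k <= N)%N by lia.
  have [ctr bnd] := I_ctr _ _ le_kN Ik.
  rewrite addn0 in eq_N; exists s1; last by rewrite -eq_N.
  by rewrite mul0n; apply: ExecWhileStop; rewrite /= bnd ctr; lia.
have [ctr bnd] := I_ctr _ _ le_kN Ik.
have lt_kN : (k < N)%N by lia.
have [s2 ex2 [ctr2 I2]] := I_body _ _ lt_kN Ik.
have [|s3 ex3 I3] := IH k.+1 _ _ I2; first by lia.
exists s3 => //; rewrite mulSn; apply: (ExecWhileLoop _ _ ex3).
  by rewrite /= bnd ctr; lia.
rewrite -[T]addn0; apply: (ExecSeq ex2).
by rewrite -[k.+1]addn1 -{1}ctr2; apply: (ExecNatSet (Cst c)).
Qed.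

(** * Matrices in memory and preserved cells *)

Section Memory.
Variable R : comNzRingType.
Implicit Types s : state R.

Definition stores n s (b : nat) (B : 'M[R]_n) : Prop :=
  forall i j : 'I_n, rmem s (b + (i * n + j)) = B i j.

(** Only the nat cells in [l] and the ring cells from [d] on may change, so matrices stored below a
    freshly written block survive. *)
Definition frame (l : seq nat) (d : nat) s0 s : Prop :=
  (forall c, c \notin l -> nmem s c = nmem s0 c) /\
  (forall a, (a < d)%N -> rmem s a = rmem s0 a).

Lemma frame_nset l d s0 s c v :
  c \in l -> frame l d s0 s -> frame l d s0 (nset s c v).
Proof.
move=> c_in [fn fr]; split=> // c' c'_notin.
by rewrite /= /upd ifN ?fn //; apply: contraNneq c'_notin => ->.
Qed.

Lemma frame_rset l d s0 s a v :
  (d <= a)%N -> frame l d s0 s -> frame l d s0 (rset s a v).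
Proof.
move=> le_da [fn fr]; split=> // a' lt_a'd.
by rewrite /= /upd ifN ?fr // neq_ltn (leq_trans lt_a'd).
Qed.

Lemma frame_trans l1 l2 d1 d2 s0 s1 s2 :
  {subset l1 <= l2} -> (d2 <= d1)%N ->
  frame l2 d2 s0 s1 -> frame l1 d1 s1 s2 -> frame l2 d2 s0 s2.
Proof.
move=> sub_l le_d [fn1 fr1] [fn2 fr2]; split=> [c c_notin|a lt_a].
  by rewrite fn2 ?fn1 //; apply: contra c_notin; apply: sub_l.
by rewrite fr2 ?fr1 // (leq_trans lt_a).
Qed.

Lemma ord_index_lt n (i j : 'I_n) : (i * n + j < n * n)%N.
Proof. by case: i j => [i lt_i] [j lt_j] /=; nia. Qed.

Lemma stores_frame n l d s0 s b (B : 'M[R]_n) :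
  (b + n * n <= d)%N -> frame l d s0 s -> stores n s0 b B -> stores n s b B.
Proof.
move=> le_d [_ fr] st i j; rewrite fr ?st //.
by apply: leq_trans le_d; rewrite ltn_add2l ord_index_lt.
Qed.

End Memory.

Arguments stores {R n}.
Arguments frame {R}.

(** * Repeated squaring on the machine *)

Definition entry (b i j : nexpr) : nexpr := Plus b (Plus (Times i (cell 0)) j).

(* Nat cells 7, 8 and 9 hold the addresses of the factors and of the product;
   the ring cell just behind the product is scratch space. *)
Definition MatMul : prog :=
  let out := entry (cell 9) (cell 4) (cell 5) in
  let tmp := Plus (cell 9) (Times (cell 0) (cell 0)) in
  For 4 (cell 0) (For 5 (cell 0) (Seq (RingZero out) (For 6 (cell 0)
    (Seq (RingMul tmp (entry (cell 7) (cell 4) (cell 6))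
                      (entry (cell 8) (cell 6) (cell 5)))
         (RingAdd out out tmp))))).

(** * Correctness of the matrix product *)

Section MatMulCorrect.
Variables (R : comNzRingType) (n x y d : nat) (X Y : 'M[R]_n) (s0 : state R).
Hypotheses (n_cell : nmem s0 0 = n) (x_cell : nmem s0 7 = x).
Hypotheses (y_cell : nmem s0 8 = y) (d_cell : nmem s0 9 = d).
Hypotheses (x_le : (x + n * n <= d)%N) (y_le : (y + n * n <= d)%N).
Hypotheses (x_stores : stores s0 x X) (y_stores : stores s0 y Y).

Let keeps := frame [:: 4; 5; 6]%N d s0.

(** Entries are produced in row-major order, so one number records the progress. *)
Let done (m : nat) (s : state R) := forall i j : 'I_n, (i * n + j < m)%N ->
  rmem s (d + (i * n + j)) = (X *m Y) i j.

Let partial i j k : R :=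
  \sum_(0 <= l < k) rmem s0 (x + (i * n + l)) * rmem s0 (y + (l * n + j)).

Lemma cells_of_keeps s : keeps s ->
  [/\ nmem s 0 = n, nmem s 7 = x, nmem s 8 = y & nmem s 9 = d].
Proof. by move=> [fn _]; rewrite !fn. Qed.

Lemma runs_dot_product s i j : (i < n)%N -> (j < n)%N ->
  keeps s -> nmem s 4 = i -> nmem s 5 = j -> done (i * n + j) s ->
  rmem s (d + (i * n + j)) = 0 ->
  let out := entry (cell 9) (cell 4) (cell 5) in
  let tmp := Plus (cell 9) (Times (cell 0) (cell 0)) in
  runs (For 6 (cell 0)
    (Seq (RingMul tmp (entry (cell 7) (cell 4) (cell 6))
                      (entry (cell 8) (cell 6) (cell 5)))
         (RingAdd out out tmp))) s (n * 2)
    (fun s' => [/\ keeps s', nmem s' 4 = i, nmem s' 5 = j &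
                   done (i * n + j).+1 s']).
Proof.
move=> lt_i lt_j ks s4 s5 dn out0 out tmp.
pose I k s' := [/\ keeps s', [/\ nmem s' 4 = i, nmem s' 5 = j & nmem s' 6 = k],
  done (i * n + j) s' & rmem s' (d + (i * n + j)) = partial i j k].
apply: (@runs_weaken _ (I n)) => [s' [ks' [s'4 s'5 _] dn' out']|].
  split=> // i' j'; rewrite ltnS leq_eqVlt => /predU1P[eq_ij|]; last exact: dn'.
  (* Euclidean division by [n] recovers row and column from the row-major index. *)
  have [eq_i eq_j] : nat_of_ord i' = i /\ nat_of_ord j' = j.
    have n_gt0 : (0 < n)%N := leq_ltn_trans (leq0n _) lt_i.
    have eq_i : nat_of_ord i' = i.
      have /(congr1 (divn^~ n)) := eq_ij.
      by rewrite !divnMDl // !divn_small ?addn0.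
    by split=> //; apply/eqP; rewrite -(eqn_add2l (i * n)) -eq_ij eq_i.
  rewrite eq_ij out' mxE /partial big_mkord; apply: eq_bigr => l _.
  by rewrite -x_stores -y_stores eq_i eq_j.
apply: runs_for => [k s' _ [/cells_of_keeps[c0 _ _ _] [_ _ ->] _ _]|
                   |k s' lt_k [ks' [s'4 s'5 s'6] dn' out']].
- by split.
- split=> //; last by rewrite /partial big_geq.
  exact: frame_nset.
have [c0 c7 c8 c9] := cells_of_keeps _ ks'.
have lt_ij : (i * n + j < n * n)%N := ord_index_lt n (Ordinal lt_i) (Ordinal lt_j).
apply: (@runs_seq _ 1 1); apply: runs_ring_mul; apply: runs_ring_add.
rewrite /= c0 c7 c8 c9 s'4 s'5 s'6.
split=> //; split=> //=.
- by apply: frame_nset => //; do 2![apply: frame_rset; first by lia].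
(* Finished entries come before offset [i * n + j], and the scratch cell [d + n * n] comes after all
   entries. *)
- move=> i' j' lt_ij'; rewrite /= /upd !ifN; [exact: dn'| |]; apply/eqP; lia.
rewrite /upd !eqxx ifN; last by apply/eqP; lia.
rewrite out' /partial big_nat_recr //=.
(* Both operands lie below [d], hence keep their initial values. *)
have lt_ik := ord_index_lt n (Ordinal lt_i) (Ordinal lt_k).
have lt_kj := ord_index_lt n (Ordinal lt_k) (Ordinal lt_j).
by have [_ fr] := ks'; rewrite !fr //=; move: lt_ik lt_kj => /=; lia.
Qed.

Lemma runs_matmul : runs MatMul s0 (n * (n * (n * 2)))
  (fun s => keeps s /\ stores s d (X *m Y)).
Proof.
pose I i s := [/\ keeps s, nmem s 4 = i & done (i * n) s].
apply: (@runs_weaken _ (I n)) => [s [ks _ dn]|].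
  by split=> // i j; apply: dn; apply: ord_index_lt.
apply: runs_for => [i s _ [/cells_of_keeps[c0 _ _ _] -> _]||i s lt_i [ks s4 dn]].
- by split.
- by split=> //; apply: frame_nset.
pose J j s := [/\ keeps s, nmem s 4 = i, nmem s 5 = j & done (i * n + j) s].
apply: (@runs_weaken _ (J n)) => [s' [ks' s'4 _ dn']|].
  split=> //; split=> //; last by rewrite mulSn addnC.
  exact: frame_nset.
apply: runs_for => [j s' _ [/cells_of_keeps[c0 _ _ _] _ -> _]||j s' lt_j [ks' s'4 s'5 dn']].
- by split.
- by split=> //; [apply: frame_nset | rewrite addn0].
have [c0 c7 c8 c9] := cells_of_keeps _ ks'.
apply: (@runs_seq _ 0); apply: runs_ring_zero; rewrite /= c0 c9 s'4 s'5.
apply: runs_weaken (runs_dot_product _ i j lt_i lt_j _ _ _ _ _) => //=.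
- move=> s'' [ks'' s''4 s''5 dn'']; split=> //; split=> //; last by rewrite addnS.
  exact: frame_nset.
- by apply: frame_rset => //; apply: leq_addr.
- by move=> i' j' lt_ij; rewrite /= /upd ifN ?dn' //; apply/eqP; lia.
- by rewrite /upd eqxx.
Qed.

End MatMulCorrect.

(* Block k, at ring address k * n ^ 2, receives A ^ (2 ^ k); the last block
   receives A times the last power. *)
Definition decide_fixed_point : prog :=
  let block k := Times k (Times (cell 0) (cell 0)) in
  let next k := block (Plus k (Cst 1)) in
  Seq (For 3 (cell 2)
         (Seq (NatSet (Cst 7) (block (cell 3)))
         (Seq (NatSet (Cst 8) (block (cell 3)))
         (Seq (NatSet (Cst 9) (next (cell 3))) MatMul))))
  (Seq (NatSet (Cst 7) (Cst 0))
  (Seq (NatSet (Cst 8) (block (cell 2)))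
  (Seq (NatSet (Cst 9) (next (cell 2)))
  (Seq MatMul
  (Seq (NatSet (Cst 6) (Cst 1))
  (Seq (For 3 (Times (cell 0) (cell 0))
          (Seq (RingEq (Cst 4) (Plus (cell 8) (cell 3)) (Plus (cell 9) (cell 3)))
               (NatSet (Cst 6) (Times (cell 6) (cell 4)))))
       (NatSet (Cst 0) (cell 6)))))))).

(** * Correctness of the decision program *)

Lemma all_entries_eq (R : comNzRingType) n (s : state R) b d (B D : 'M[R]_n) :
  stores s b B -> stores s d D ->
  all (fun m => rmem s (b + m) == rmem s (d + m)) (iota 0 (n * n)) = (B == D).
Proof.
move=> sB sD; apply/allP/eqP => [eq_all|eq_BD m].
  apply/matrixP=> i j; rewrite -sB -sD; apply/eqP/eq_all.
  by rewrite mem_iota ord_index_lt.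
rewrite mem_iota add0n /= => lt_m.
have n_gt0 : (0 < n)%N by lia.
have lt_div : (m %/ n < n)%N by rewrite ltn_divLR.
rewrite (divn_eq m n); apply/eqP.
have := sB (Ordinal lt_div) (Ordinal (ltn_pmod m n_gt0)).
by rewrite eq_BD -sD.
Qed.

Lemma runs_decide (R : comNzRingType) n K (A : 'M[R]_n) (s0 : state R) :
  nmem s0 0 = n -> nmem s0 2 = K -> stores s0 0 A ->
  runs decide_fixed_point s0
    (K * (n * (n * (n * 2))) + (n * (n * (n * 2)) + n * n))
    (fun s => nmem s 0 = (A ^+ (2 ^ K) == A *m A ^+ (2 ^ K))).
Proof.
move=> s00 s02 sA; apply: runs_seq.
(* Round [k] squares block [k] into block [k.+1]; initially block 0 serves as [A ^+ (2 ^ 0)]. *)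
pose I k (s : state R) := [/\ nmem s 0 = n, nmem s 2 = K, nmem s 3 = k,
  stores s 0 A & stores s (k * (n * n)) (A ^+ (2 ^ k))].
apply: (@runs_weaken _ (I K)) => [s1 [s10 s12 _ sA1 sP1]|]; last first.
  apply: runs_for => [k s _ [s_0 s_2 s_3 _ _]||k s lt_k [s_0 s_2 s_3 sA1 sP1]].
  - by split.
  - by split.
  do 3![apply: (@runs_seq _ 0); apply: runs_nat_set]; rewrite /= /upd /= s_0 s_3.
  set s1 := nset _ _ _.
  have fr1 : frame [:: 7; 8; 9]%N (k.+1 * (n * n)) s s1.
    by do 3![apply: frame_nset => //].
  have stP : stores s1 (k * (n * n)) (A ^+ (2 ^ k)).
    by apply: stores_frame fr1 sP1; rewrite mulSn addnC.
  apply: runs_weaken (runs_matmul R n (k * (n * n)) (k * (n * n))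
     (k.+1 * (n * n)) _ _ s1 _ _ _ _ _ _ stP stP) => //=; rewrite ?addn1 //;
     try by rewrite mulSn addnC.
  move=> s2 [fr2 st2].
  have [fn2 _] := fr2; rewrite !fn2 //=.
  split=> //; split=> //; rewrite /= /upd /= ?fn2 //.
  - have fr : frame [:: 3; 4; 5; 6; 7; 8; 9]%N (k.+1 * (n * n)) s s2.
      apply: (@frame_trans _ _ _ _ _ s s1 s2 _ (leqnn _) _ fr2).
        by move=> c; rewrite !inE => /or3P[] /eqP->.
      by do 3![apply: frame_nset => //].
    by apply: (@stores_frame _ _ _ _ _ _ _ _ _ fr sA1); rewrite mulSn leq_addr.
  - by move=> i j; rewrite /= st2 mulmxE -exprD addnn -mul2n -expnS.
do 3![apply: (@runs_seq _ 0); apply: runs_nat_set]; rewrite /= /upd /= s10 s12.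
apply: runs_seq; set s2 := nset _ _ _.
have fr2 : frame [:: 7; 8; 9]%N (K.+1 * (n * n)) s1 s2.
  by do 3![apply: frame_nset => //].
(* Blocks 0 and [K] end before block [K.+1], so the last product leaves both factors intact. *)
have le_K : (K * (n * n) + n * n <= K.+1 * (n * n))%N by rewrite mulSn addnC.
have le_0 : (0 + n * n <= K.+1 * (n * n))%N by rewrite mulSn leq_addr.
have stA := stores_frame _ _ _ _ _ _ _ _ le_0 fr2 sA1.
have stP := stores_frame _ _ _ _ _ _ _ _ le_K fr2 sP1.
apply: runs_weaken (runs_matmul R n 0 (K * (n * n))
     (K.+1 * (n * n)) _ _ s2 _ _ _ _ _ _ stA stP) => //=; rewrite ?addn1 //.
move=> s3 [fr3 st3].
have [fn3 _] := fr3.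
have {}stP := stores_frame _ _ _ _ _ _ _ _ le_K fr3 stP.
apply: (@runs_seq _ 0 (n * n)); apply: runs_nat_set => /=.
rewrite -(all_entries_eq _ _ _ _ _ _ _ stP st3).
set b := (K * _)%N in stP *; set d := (K.+1 * _)%N in st3 *.
(* The cost is split into [n * n] rounds of one test each and a free final assignment. *)
rewrite -[X in runs _ _ X _]addn0 -[X in runs _ _ (X + _) _]muln1.
pose test m := rmem s3 (b + m) == rmem s3 (d + m).
(* Cell 6 holds the product of the 0/1 outcomes so far, that is, their conjunction; cells 8 and 9
   still address the two matrices. *)
pose J k s := [/\ rmem s = rmem s3, [/\ nmem s 0 = n, nmem s 8 = b & nmem s 9 = d],
  nmem s 3 = k & nmem s 6 = all test (iota 0 k)].
apply: runs_seq; apply: (@runs_weaken _ (J (n * n)%N)).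
  by move=> s4 [_ _ _ s46]; apply: runs_nat_set; rewrite /= s46.
apply: runs_for => [k s _ [_ [s_0 _ _] -> _]||k s lt_k [rs [s_0 s_8 s_9] s_3 s_6]].
- by rewrite /= s_0.
- by split; rewrite //= /upd /= !fn3 //= /upd /= ?addn1.
apply: (@runs_seq _ 1 0); apply: runs_ring_eq; apply: runs_nat_set.
have all_next : all test (iota 0 k.+1) = all test (iota 0 k) && test k.
  by rewrite -[k.+1]addn1 iotaD all_cat /= andbT.
rewrite /= /upd /= s_8 s_9 s_3 s_6 rs; split=> //; split=> //.
by rewrite all_next -mulnb.
Qed.

(** * Row-major input and conclusion *)

Lemma nth_allpairs (S T U : Type) (x0 : S) (y0 : T) (z0 : U) (f : S -> T -> U)
    (s : seq S) (t : seq T) i j : (i < size s)%N -> (j < size t)%N ->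
  nth z0 [seq f x y | x <- s, y <- t] (i * size t + j) = f (nth x0 s i) (nth y0 t j).
Proof.
elim: s i => [//|x s IH] [|i] lt_i lt_j; rewrite /= nth_cat size_map.
  by rewrite mul0n add0n lt_j (nth_map y0).
by rewrite mulSn -addnA ltnNge leq_addr /= addKn IH.
Qed.

Lemma stores_input (R : comNzRingType) (n q : nat) (A : 'M[R]_n) b :
  stores (input q A b) 0 A.
Proof.
move=> i j; rewrite /= add0n.
have := @nth_allpairs _ _ _ i j 0 (fun i j => A i j) (enum 'I_n) (enum 'I_n) i j.
by rewrite size_enum_ord !nth_ord_enum; apply.
Qed.

Theorem mainTheorem2 :
  exists (P : prog) (C : Rdefinitions.R),
  forall (R : finComNzRingType) (q n : nat) (A : 'M[R]_n),
    #|R| = q -> (1 < q)%N -> (0 < n)%N -> (n, q) <> (1%N, 2%N) ->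
    exists (t : nat) (s : state R),
      [/\ exec P (input q A (binary (ceil_nlog2q n q))) t s,
          fixed_point_system (fun x : 'cV[R]_n => A *m x) -> accepts s,
          ~ fixed_point_system (fun x : 'cV[R]_n => A *m x) -> rejects s &
          t%:R <= C * n%:R ^+ 3 * log2 (n%:R * log2 q%:R)].
Proof.
exists decide_fixed_point, 16 => R q n A card_R q_gt1 n_gt0 nq_neq.
set b := binary _.
(* Nat cell 2 of the input holds [size b], which thus becomes the number of squarings. *)
have [s ex res] := runs_decide _ n (size b) A (input q A b) erefl erefl
                     (stores_input _ _ _ _ _).
have le_q : (#|R| ^ n <= 2 ^ (2 ^ size b))%N.
  by rewrite card_R expn_le_pow2_binary.
have fpsP := fixed_point_system_mulmxP R n A _ le_q.
eexists _, s; split; first exact: ex.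
- by move=> /fpsP fix_m; rewrite /accepts res fix_m eqxx.
- move=> not_fps; rewrite /rejects res; case: eqP => // eq_m.
  by case: not_fps; apply/fpsP.
- exact: cost_bound.
Qed.
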